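(* Let $G=(V,E)$ be a finite, strongly connected directed graph and consider a locally Markov walk on $G$ with strictly positive local transition probabilities, i.e. $\mathsf{m}_x(y,z)>0$ for all $x\in V$ and all $y,z\in N_x$. Then the corresponding total chain, on its set of recurrent states $\mathsf{U}_G$, is irreducible: for all $(x,\rho),(y,\eta)\in\mathsf{U}_G$ there is $n\in\mathbb{N}$ such that the total chain started at $(x,\rho)$ is at $(y,\eta)$ at time $n$ with positive probability.
   Context: Graph: $G=(V,E)$ is a finite directed graph without loops or multiple edges, strongly connected, $|V|\ge 2$; $N_x=\{y\in V:(x,y)\in E\}$. Local chains: for every $x\in V$ a stochastic matrix $\mathsf{M}_x=(\mathsf{m}_x(y,z))_{y,z\in N_x}$ is given, the transition matrix of the local chain at $x$. Total chain of the locally Markov walk: a configuration is a map $\rho:V\to V$ with $\rho(x)\in N_x$ for all $x$. The total chain $(X_n,\rho_n)_{n\in\mathbb{N}}$ is the Markov chain on pairs (vertex, configuration) with one-step transition probabilities $$p((x,\rho),(y,\eta))=\begin{cases}\mathsf{m}_x(\rho(x),y),&\text{if }\eta(v)=\rho(v)\text{ for all }v\ne x\text{ and }\eta(x)=y,\\0,&\text{otherwise.}\end{cases}$$ The first coordinate $(X_n)_{n\in\mathbb{N}}$ is the locally Markov walk. A configuration $\rho$ is a spanning unicycle of $G$ if the subgraph with edge set $\{(v,\rho(v)):v\in V\}$ contains exactly one directed cycle. $\mathsf{U}_G$ is the set of pairs $(x,\rho)$ such that $\rho$ is a spanning unicycle of $G$ and $x$ lies on its unique cycle; this is the set of recurrent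 states of the total chain. *)

(* Defs.v *)
From HB Require Import structures.
From mathcomp Require Import all_boot all_order all_algebra.
From mathcomp Require Import reals.

Set Implicit Arguments.
Unset Strict Implicit.
Unset Printing Implicit Defensive.

Import Order.TTheory GRing.Theory Num.Theory.
Local Open Scope ring_scope.

Section Digraph.
Variables (V : finType) (E : rel V).

Definition nbrs (x : V) : {set V} := [set y | E x y].

Definition strongly_connected : Prop := forall x y, connect E x y.

(* A directed cycle is given by the sequence of its (distinct) vertices, which
   determines it up to the choice of the starting vertex, i.e. up to [rot]. *)
Definition dicycle (c : seq V) : bool := (c != [::]) && ucycleb E c.

Definition unique_dicycle (c : seq V) : Prop :=
  dicycle c /\ forall c', dicycle c' -> exists k, c' = rot k c.

Record config := Config {
  config_fun :> {ffun V -> V};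
  config_nbrs : [forall x, config_fun x \in nbrs x] }.

End Digraph.

HB.instance Definition _ (V : finType) (E : rel V) :=
  [isSub for @config_fun V E].
HB.instance Definition _ (V : finType) (E : rel V) :=
  [Countable of config E by <:].
HB.instance Definition _ (V : finType) (E : rel V) :=
  [Finite of config E by <:].

(* [frel rho] is the relation whose edges are the pairs (v, rho v). *)
Definition spanning_unicycle (V : finType) (E : rel V) (rho : config E) : Prop :=
  exists c, unique_dicycle (frel rho) c.

Definition in_U (V : finType) (E : rel V) (s : V * config E) : Prop :=
  spanning_unicycle s.2 /\
  exists2 c, unique_dicycle (frel s.2) c & s.1 \in c.

Section Chains.
Variable R : realType.

(* Stochastic matrix indexed by A; the entries of M outside A are irrelevant. *)
Definition stochastic_on (T : finType) (A : {set T}) (M : T -> T -> R) : Prop :=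
  {in A &, forall y z, 0 <= M y z} /\ {in A, forall y, \sum_(z in A) M y z = 1}.

Fixpoint nstep (S : finType) (P : S -> S -> R) (n : nat) (s t : S) : R :=
  if n is n'.+1 then \sum_(u : S) P s u * nstep P n' u t else (s == t)%:R.

(* Only entries of m x indexed by nbrs E x are used: when the condition holds,
   t.1 = t.2 s.1 is a neighbour of s.1, as t.2 is a configuration. *)
Definition total_chain (V : finType) (E : rel V) (m : V -> V -> V -> R)
    (s t : V * config E) : R :=
  if [forall v, (v != s.1) ==> (t.2 v == s.2 v)] && (t.2 s.1 == t.1)
  then m s.1 (s.2 s.1) t.1 else 0.

End Chains.

(* Main.v *)
(** Write [s -> t] for a possible move of the walk. Since all local transitions
are possible, two walkers at the same vertex with different configurations can
follow a common path visiting every vertex, after which their configurations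
agree; so any two states have a common successor, and it remains to see that
moves can be undone inside [U_G]. Given a move from [(x, rho)] to [(y, eta)],
consider the rotor walk whose rotor at [x] is the transposition of [rho x] and
[y], and whose other rotors do not turn. It preserves [U_G] and is injective
there, because the vertex just left is the predecessor of the current vertex on
the unique cycle. Hence it permutes the finite set [U_G], and iterating it from
[(y, eta)] leads back to [(x, rho)]. *)
Require Import Defs.
From mathcomp Require Import all_boot all_order all_algebra.
From mathcomp Require Import perm reals.
Set Implicit Arguments.
Unset Strict Implicit.
Unset Printing Implicit Defensive.
Import Order.TTheory GRing.Theory Num.Theory.
Local Open Scope ring_scope.

(** * Forward orbits of a self-map of a finite set *)

Lemma fconnect_loop (T : finType) (f : T -> T) (v : T) :
  exists2 w, fconnect f v w & fconnect f (f w) w.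
Proof.
have /trajectP[i lt_i eq_i] := looping_order f v.
exists (iter i f v); first exact: fconnect_iter.
rewrite -iterS -[X in fconnect f _ X]eq_i -(subnK lt_i) iterD.
exact: fconnect_iter.
Qed.

(** The forward orbit of [v] runs into a cycle, which can only be [c]. *)
Lemma unique_dicycle_fconnect (V : finType) (f : V -> V) (c : seq V) (x v : V) :
  unique_dicycle (frel f) c -> x \in c -> fconnect f v x.
Proof.
move=> [_ c_uniq] xc; have [w vw fw_w] := fconnect_loop f v.
apply: connect_trans vw _; rewrite fconnect_orbit.
have [|k ->] := c_uniq (orbit f w); last by rewrite mem_rot.
rewrite /dicycle /ucycleb orbit_uniq andbT -size_eq0 size_orbit.
by rewrite -lt0n order_gt0 -fconnect_f.
Qed.

Lemma fconnect_pred_inj (T : finType) (f : T -> T) (x x' : T) :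
  f x = f x' -> fconnect f (f x) x -> fconnect f (f x) x' -> x = x'.
Proof.
move=> eq_f /iter_findex; set a := findex _ _ _ => xE.
move=> /iter_findex; set b := findex _ _ _ => x'E; set y := f x in eq_f xE x'E.
have per_a : iter a.+1 f y = y by rewrite iterS xE.
have per_b : iter b.+1 f y = y by rewrite iterS x'E.
have loop k n : iter n f y = y -> iter (k * n) f y = y.
  by move=> per; elim: k => // k IHk; rewrite mulSn iterD IHk.
(* With full periods inserted, [x] and [x'] are the same iterate of [y], as
   [a + b * a.+1 = b + a * b.+1]. *)
rewrite -xE -{1}(loop b _ per_a) -x'E -{2}(loop a _ per_b) -!iterD.
by congr (iter _ f y); rewrite !mulnS mulnC addnCA.
Qed.

(** * Moves of the walk and rooted states *)

Section Moves.
Variables (V : finType) (E : rel V).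
Local Notation state := (V * config E)%type.

Definition move (s t : state) : bool :=
  [forall v, (v != s.1) ==> (t.2 v == s.2 v)] && (t.2 s.1 == t.1).

(** The default [s.2] of [insubd] is taken only if [y] is not a neighbour of [s.1]. *)
Definition turn (s : state) (y : V) : state :=
  (y, insubd s.2 [ffun v => if v == s.1 then y else s.2 v]).

(* A concrete form of [in_U]: if every vertex leads to [s.1], then so does
   [s.2 s.1], which puts [s.1] on the only cycle. *)
Definition rooted : pred state := fun s => [forall v, fconnect s.2 v s.1].

Lemma config_edge (rho : config E) x : E x (rho x).
Proof. by have /forallP/(_ x) := config_nbrs rho; rewrite inE. Qed.

Lemma configP (rho eta : config E) : (forall v, rho v = eta v) -> rho = eta.
Proof. by move=> eq_re; apply/val_inj/ffunP. Qed.

Lemma moveP (s t : state) :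
  reflect ((forall v, v != s.1 -> t.2 v = s.2 v) /\ t.2 s.1 = t.1) (move s t).
Proof.
apply: (iffP andP) => -[st /eqP ->]; split=> //.
  by move=> v vs; apply/eqP; move/forallP/(_ v)/implyP: st; apply.
by apply/forallP=> v; apply/implyP=> /st->.
Qed.

Lemma turnE (s : state) y : E s.1 y ->
  forall v, (turn s y).2 v = if v == s.1 then y else s.2 v.
Proof.
move=> sy v; rewrite /turn /= val_insubd ifT ?ffunE //.
apply/forallP=> w; rewrite inE ffunE.
by case: eqP => [->|_] //; apply: config_edge.
Qed.

Lemma move_turn (s : state) y : E s.1 y -> move s (turn s y).
Proof.
by move=> sy; apply/moveP; split=> [v /negPf vs|]; rewrite turnE ?vs ?eqxx.
Qed.

Lemma move_edge (s t : state) : move s t -> E s.1 t.1.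
Proof. by case/moveP=> _ <-; apply: config_edge. Qed.

Lemma move_eq (s t t' : state) : move s t -> move s t' -> t.1 = t'.1 -> t = t'.
Proof.
case: t t' => [y rho] [y' rho'] /moveP[/= rhoN rhoS] /moveP[/= rhoN' rhoS'] eq_y.
congr (_, _) => //; apply: configP => v.
have [->|vs] := eqVneq v s.1; first by rewrite rhoS rhoS'.
by rewrite rhoN ?rhoN'.
Qed.

(** Until it first meets [s.1], the path of [v] under [s.2] uses only values that the move leaves
    unchanged. *)
Lemma move_connect_left (s t : state) :
  move s t -> rooted s -> forall v, fconnect t.2 v s.1.
Proof.
case/moveP=> tN _ /forallP rs v; have /iter_findex := rs v.
move: (findex _ _ _) => n; elim: n v => [|n IHn] v /=; first by move->.
rewrite -iterS iterSr => /IHn; have [-> _|vs] := eqVneq v s.1.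
  exact: connect0.
by apply: connect_trans; rewrite -tN // fconnect1.
Qed.

Lemma move_rooted (s t : state) : move s t -> rooted s -> rooted t.
Proof.
move=> st rs; apply/forallP=> v.
apply: connect_trans (move_connect_left st rs v) _.
by case/moveP: st => _ <-; apply: fconnect1.
Qed.

Lemma move_pred_inj (s s' t : state) :
  rooted s -> rooted s' -> move s t -> move s' t -> s.1 = s'.1.
Proof.
move=> rs rs' st s't; apply: (@fconnect_pred_inj _ t.2).
- by case/moveP: st => _ ->; case/moveP: s't.
- exact: move_connect_left st rs _.
- exact: move_connect_left s't rs' _.
Qed.

(** * Undoing moves by a rotor walk *)

Section Rotor.
Variables (x a b : V).
Hypotheses (Exa : E x a) (Exb : E x b).

Definition rotor_turn (z w : V) : V := if z == x then tperm a b w else w.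

Definition rotor (s : state) : state := turn s (rotor_turn s.1 (s.2 s.1)).

Lemma move_rotor s : move s (rotor s).
Proof.
apply: move_turn; rewrite /rotor_turn; have := config_edge s.2 s.1.
by case: eqP => // ->; case: tpermP.
Qed.

(** [move_pred_inj] recovers the vertex just left; its old value follows because [rotor_turn] is
    injective in its second argument. *)
Lemma rotor_inj : {in rooted &, injective rotor}.
Proof.
move=> s s' rs rs' eq_r; have st := move_rotor s; have s't := move_rotor s'.
have eq1 : s.1 = s'.1.
  by apply: move_pred_inj rs rs' st _; rewrite eq_r.
move: (congr1 fst eq_r); rewrite /= -eq1 => eqy.
have eqx : s.2 s.1 = s'.2 s.1.
  by move: eqy; rewrite /rotor_turn; case: eqP => // _; apply: perm_inj.
case/moveP: st => stN _; case/moveP: s't => s'tN _.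
rewrite (surjective_pairing s) (surjective_pairing s') -eq1.
congr (_, _); apply: configP => v.
have [->//|vs] := eqVneq v s.1.
by rewrite -stN // eq_r s'tN // -eq1.
Qed.

Lemma rotor_connect s : rooted s -> connect move (rotor s) s.
Proof.
have rr : {in rooted, forall s, rotor s \in rooted}.
  by move=> t rt; apply: move_rooted (move_rotor t) rt.
move=> rs.
(* On the invariant finite set [rooted] the injective map [rotor] has cyclic orbits. *)
have : fconnect rotor (rotor s) s.
  by rewrite (fconnect_sym_in rr rotor_inj) ?fconnect1 // rr.
apply: connect_sub => t _ /eqP <-; apply: connect1; exact: move_rotor.
Qed.

End Rotor.

Lemma move_connect_rev (s t : state) :
  rooted s -> move s t -> connect move t s.
Proof.
move=> rs st.
have Ea := config_edge s.2 s.1; have Eb := move_edge st.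
suff -> : t = rotor s.1 (s.2 s.1) t.1 s by apply: rotor_connect.
apply: move_eq st (move_rotor Ea Eb s) _.
by rewrite /= /rotor_turn eqxx tpermL.
Qed.

Lemma connect_move_rev (s t : state) :
  rooted s -> connect move s t -> connect move t s.
Proof.
move=> rs /connectP[p + ->]; elim: p s rs => [|u p IHp] s rs /=.
  by rewrite connect0.
case/andP=> su /(IHp _ (move_rooted su rs)) pu.
exact: connect_trans pu (move_connect_rev rs su).
Qed.

(** * Coupling two walkers along a common path *)

Lemma coupled_walk (s t : state) p : s.1 = t.1 -> path E s.1 p ->
  exists s' t' : state,
  [/\ connect move s s', connect move t t', s'.1 = last s.1 p, t'.1 = s'.1
   & forall v, (v \in belast s.1 p) || (s.2 v == t.2 v) -> s'.2 v = t'.2 v].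
Proof.
elim: p s t => [|y p IHp] s t eq1 /=.
  by move=> _; exists s, t; split=> // v /eqP.
case/andP=> sy py; have ty : E t.1 y by rewrite -eq1.
have [s' [t' [ss' tt' s'E t'E agree]]] := IHp (turn s y) (turn t y) erefl py.
exists s', t'; split=> //.
- exact: connect_trans (connect1 (move_turn sy)) ss'.
- exact: connect_trans (connect1 (move_turn ty)) tt'.
(* After the first step both configurations send [s.1] to [y], and agreement elsewhere is kept. *)
move=> v; rewrite inE -orbA => hv; apply: agree; rewrite !turnE // -eq1.
by case: eqP hv => [_ _|_ //]; rewrite eqxx orbT.
Qed.

Hypothesis E_connected : strongly_connected E.

(** Induction on the number of vertices where the configurations differ: a common path leaving such
    a vertex removes it and creates no new one. *)
Lemma coalesce (s t : state) : s.1 = t.1 ->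
  exists r, connect move s r /\ connect move t r.
Proof.
have [n] := ubnP #|[set v | s.2 v != t.2 v]|.
elim: n s t => // n IHn s t le_n eq1.
have [/existsP[v vN] | /existsPn eq2] := boolP [exists v, s.2 v != t.2 v].
  have /connectP[p sp pv] := E_connected s.1 v.
  (* The extra step makes the walkers leave [v], so that [v] lies in [belast]. *)
  have sp' : path E s.1 (rcons p (s.2 v)).
    by rewrite rcons_path sp -pv config_edge.
  have [s' [t' [ss' tt' _ t'E agree]]] := coupled_walk eq1 sp'.
  have lt_n : (#|[set v | s'.2 v != t'.2 v]| < n)%N.
    rewrite -ltnS; apply: leq_trans le_n; rewrite ltnS; apply: proper_card.
    apply/properP; split.
      apply/subsetP=> w; rewrite !inE; apply: contraNneq => eq_w.
      by apply/eqP/agree; rewrite eq_w eqxx orbT.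
    exists v; rewrite !inE // negbK; apply/eqP/agree.
    by rewrite belast_rcons pv mem_last.
  have [r [s'r t'r]] := IHn _ _ lt_n (esym t'E).
  by exists r; split; [apply: connect_trans s'r | apply: connect_trans t'r].
exists t; split=> //.
rewrite (surjective_pairing s) (surjective_pairing t) eq1 (@configP s.2 t.2) //.
by move=> v; apply/eqP; rewrite -[_ == _]negbK eq2.
Qed.

(** Once led to [t.1], the walker has a common successor [r] with [t]; the moves from [t] to [r] are
    then undone. *)
Lemma rooted_reachable (s t : state) : rooted t -> connect move s t.
Proof.
move=> rt; have /connectP[p sp pE] := E_connected s.1 t.1.
have [s' [_ [ss' _ s'E _ _]]] := coupled_walk (erefl s.1) sp.
have [r [s'r tr]] : exists r, connect move s' r /\ connect move t r.
  by apply: coalesce; rewrite s'E pE.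
apply: connect_trans ss' (connect_trans s'r _).
exact: connect_move_rev.
Qed.

End Moves.

Lemma in_U_rooted (V : finType) (E : rel V) (s : V * config E) :
  in_U s -> rooted s.
Proof.
case=> _ [c c_uniq sc]; apply/forallP=> v.
exact: unique_dicycle_fconnect c_uniq sc.
Qed.

(** * From possible moves to positive probabilities *)

Section Positivity.
Variable R : realType.

Lemma nstep_ge0 (S : finType) (P : S -> S -> R) n s t :
  (forall s t, 0 <= P s t) -> 0 <= nstep P n s t.
Proof.
move=> P0; elim: n s => [|n IHn] s /=; first exact: ler0n.
by apply: sumr_ge0 => u _; apply: mulr_ge0.
Qed.

Lemma connect_nstep_gt0 (S : finType) (e : rel S) (P : S -> S -> R) s t :
  (forall s t, 0 <= P s t) -> (forall s t, e s t -> 0 < P s t) ->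
  connect e s t -> exists n, 0 < nstep P n s t.
Proof.
move=> P0 Pe /connectP[p + ->]; elim: p s => [|u p IHp] s /=.
  by exists 0%N; rewrite /= eqxx ltr01.
case/andP=> su /IHp[n n_gt0]; exists n.+1 => /=.
(* The summand of [u] is positive and the others are nonnegative. *)
rewrite (bigD1 u) //= ltr_wpDr ?mulr_gt0 ?Pe //.
by apply: sumr_ge0 => v _; rewrite mulr_ge0 ?nstep_ge0.
Qed.

Lemma total_chain_gt0 (V : finType) (E : rel V) (m : V -> V -> V -> R)
    (s t : V * config E) :
  (forall x y z : V, y \in nbrs E x -> z \in nbrs E x -> 0 < m x y z) ->
  move s t -> 0 < total_chain m s t.
Proof.
move=> m_gt0 st; rewrite /total_chain -/(move s t) st.
by apply: m_gt0; rewrite inE ?config_edge // (move_edge st).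
Qed.

End Positivity.

Theorem proposition3p5 (R : realType) (V : finType) (E : rel V)
    (loopless : irreflexive E)
    (E_connected : strongly_connected E)
    (V_ge2 : (1 < #|V|)%N)
    (m : V -> V -> V -> R)
    (m_stochastic : forall x : V, stochastic_on (nbrs E x) (m x))
    (m_positive : forall x y z : V,
        y \in nbrs E x -> z \in nbrs E x -> 0 < m x y z) :
  forall (x : V) (rho : config E) (y : V) (eta : config E),
    in_U (x, rho) -> in_U (y, eta) ->
    exists n : nat, 0 < nstep (total_chain m) n (x, rho) (y, eta).
Proof.
move=> x rho y eta _ Uy.
have chain_gt0 (s t : V * config E) : move s t -> 0 < total_chain m s t.
  exact: total_chain_gt0.
apply: (@connect_nstep_gt0 _ _ (@move V E)) => //; last first.
  exact/rooted_reachable/in_U_rooted.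
move=> s t; have [/chain_gt0/ltW//|/negPf st] := boolP (move s t).
by rewrite /total_chain -/(move s t) st.
Qed.
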